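(* Let $k\ge 4$ and let $\{n_1,\dots,n_k\}$ be a multiset of $k$ positive integers with $n_i\le 3$ for each $i$. Then $\{n_1,\dots,n_k\}$ is representable, except that $\{1,3,3,3\}$ (with $k=4$) is not representable.
   Context: All point sets are finite subsets of the Euclidean plane. A point $x$ blocks two points $v$ and $w$ if $x$ is in the interior of the line segment $\overline{vw}$. Two points $v,w$ are visible with respect to a point set $P$ if no point in $P$ blocks $v$ and $w$. A point set $P$ is $k$-blocked if each point in $P$ is assigned one of $k$ colours such that each pair of distinct points $v,w\in P$ are visible with respect to $P$ if and only if $v$ and $w$ are coloured differently. For a multiset $\{n_1,\dots,n_k\}$ of $k$ positive integers, $P$ is $\{n_1,\dots,n_k\}$-blocked if it is $k$-blocked and for some labelling of the colours by $1,\dots,k$, the $i$-th colour class has exactly $n_i$ points for each $i$. The multiset $\{n_1,\dots,n_k\}$ is representable if there is an $\{n_1,\dots,n_k\}$-blocked point set. *)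

(* Defs.v *)
From HB Require Import structures.
From mathcomp Require Import all_boot all_order all_fingroup all_algebra.
From mathcomp Require Import finmap reals.

Set Implicit Arguments.
Unset Strict Implicit.
Unset Printing Implicit Defensive.

Import Order.TTheory GRing.Theory Num.Theory.

Local Open Scope fset_scope.
Local Open Scope ring_scope.

Definition blocks (R : realType) (x v w : 'rV[R]_2) : Prop :=
  exists t : R, 0 < t < 1 /\ x = (1 - t) *: v + t *: w.

Definition visible (R : realType) (P : {fset 'rV[R]_2}) (v w : 'rV[R]_2) :
    Prop :=
  ~ exists2 x, x \in P & blocks x v w.

(* The colouring is a total function on the plane; only its values on [P]
   matter. *)
Definition blocking_colouring (R : realType) (k : nat) (P : {fset 'rV[R]_2})
    (c : 'rV[R]_2 -> 'I_k) : Prop :=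
  forall v w, v \in P -> w \in P -> v != w -> (visible P v w <-> c v != c w).

(* The tuple [n] lists a multiset of [k] integers; the permutation [s] of the
   colours makes the notion independent of the order of the listing. *)
Definition multiset_blocked (R : realType) (k : nat) (n : k.-tuple nat)
    (P : {fset 'rV[R]_2}) : Prop :=
  exists c : 'rV[R]_2 -> 'I_k,
    blocking_colouring P c /\
    exists s : 'S_k,
      forall i : 'I_k, #|` [fset x in P | c x == s i]| = tnth n i.

Definition representable (R : realType) (k : nat) (n : k.-tuple nat) : Prop :=
  exists P : {fset 'rV[R]_2}, multiset_blocked n P.
Arguments representable R {k} n.

(* Main.v *)
(* Non-representability of {1,3,3,3}.  No four points of such a set are
   collinear (they would all have the same colour), so the 9 monochromatic
   pairs have blockers of another colour, and if x is between v and w then for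
   every other point y the triangles vxy, xwy and vwy have the same nonzero
   orientation.  Together with the three-term Grassmann-Pluecker relations,
   these equalities are already contradictory: for every assignment of blockers
   to the 9 pairs, unit propagation of orientation signs reaches a conflict.
   Up to relabelling, either two edges of one triangle are blocked by points of
   the same other triangle, or the single point blocks an edge of each triangle;
   a verified exhaustive search refutes both cases.

   Representability.  Let x, y, z be non-collinear points of a blocked set P.
   For 0 < t < 1 there is a unique triangle abc with x = (1-t)a + tb,
   y = (1-t)b + tc and z = (1-t)c + ta.  For generic t its vertices lie on no
   line spanned by P, so any one, two or three of them form a new colour class.
   It remains to exhibit nine small blocked sets. *)

Require Import Defs.
From HB Require Import structures.
From Stdlib Require Import BinPos FMapPositive.
From mathcomp Require Import all_boot all_order all_fingroup all_algebra.
From mathcomp Require Import boolp finmap reals ring lra zify.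

Set Implicit Arguments.
Unset Strict Implicit.
Unset Printing Implicit Defensive.

(** * Propagation of orientation signs *)

Module PM := PositiveMap.

Inductive sgn := Neg | Zer | Pos.

Definition sgn_neg s := match s with Neg => Pos | Zer => Zer | Pos => Neg end.
Definition sgn_flip (b : bool) s := if b then sgn_neg s else s.
Definition sgn_mul s t :=
  match s with Neg => sgn_neg t | Zer => Zer | Pos => t end.
Definition sgn_eqb s t :=
  match s, t with Neg, Neg | Zer, Zer | Pos, Pos => true | _, _ => false end.

(* The sign patterns of three real numbers with sum zero. *)
Definition vanishing s t u :=
  match s, t, u with
  | Zer, Zer, Zer => true
  | _, _, _ =>
    (match s, t, u with Pos, _, _ | _, Pos, _ | _, _, Pos => true
                      | _, _, _ => false end) &&
    (match s, t, u with Neg, _, _ | _, Neg, _ | _, _, Neg => true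
                      | _, _, _ => false end)
  end.

(* The sign of the third summand when the sum vanishes; [None] also covers
   [Zer, Zer], where nothing needs to be inferred. *)
Definition forced s t :=
  match s, t with
  | Pos, Pos | Pos, Zer | Zer, Pos => Some Neg
  | Neg, Neg | Neg, Zer | Zer, Neg => Some Pos
  | _, _ => None
  end.

(* Combinatorial number system: the triples i < j < k < 10 get the keys 1..120. *)
Definition key i j k :=
  Pos.of_succ_nat (nth 0 [:: 0; 0; 0; 1; 4; 10; 20; 35; 56; 84] k +
                   nth 0 [:: 0; 0; 1; 3; 6; 10; 15; 21; 28; 36] j + i).

(* The boolean tells whether sorting [a, b, c] is an odd permutation. *)
Definition oriented_key a b c :=
  if a < b then
    if b < c then (key a b c, false)
    else if a < c then (key a c b, true) else (key c a b, false)
  else if a < c then (key b a c, true)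
  else if b < c then (key b c a, false) else (key c b a, true).

Definition term := (positive * positive * bool)%type.
Definition relation := (term * term * term)%type.

Definition bracket_product (f : bool) a b c d e : term :=
  let: (k, s) := oriented_key a b c in
  let: (l, t) := oriented_key a d e in (k, l, f (+) s (+) t).

(* [abc][ade] - [abd][ace] + [abe][acd] = 0 *)
Definition pluecker_relation a b c d e : relation :=
  (bracket_product false a b c d e, bracket_product true a b d c e,
   bracket_product false a b e c d).

Definition labels := iota 0 10.

(** One relation for each pivot [a] and each set of four further labels: reordering [b], [c], [d],
    [e] changes it at most by a global sign. *)
Definition relations : seq relation :=
  flatten [seq flatten [seq flatten [seq flatten [seq
    [seq pluecker_relation a b c d e | e <- labels & (d < e) && (e != a)]
    | d <- labels & (c < d) && (d != a)] | c <- labels & (b < c) && (c != a)]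
    | b <- labels & b != a] | a <- labels].

Definition push (A : Type) (m : PM.t (seq A)) k (x : A) :=
  PM.add k (x :: odflt [::] (PM.find k m)) m.

Definition watch (m : PM.t (seq relation)) (g : relation) :=
  let: ((k1, k2, _), (k3, k4, _), (k5, k6, _)) := g in
  push (push (push (push (push (push m k1 g) k2 g) k3 g) k4 g) k5 g) k6 g.

Definition watched := foldl watch (PM.empty _) relations.

(* [Half k u]: the term has sign (sign of [k]) * [u], with [u] nonzero and [k]
   not assigned yet. *)
Inductive tval := Known of sgn | Half of positive & sgn | Open.

Definition term_val (st : PM.t sgn) (t : term) :=
  let: (k, l, f) := t in
  match PM.find k st with
  | Some Zer => Known Zer
  | Some s =>
    match PM.find l st with
    | Some s' => Known (sgn_flip f (sgn_mul s s'))
    | None => Half l (sgn_flip f s)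
    end
  | None =>
    match PM.find l st with
    | Some Zer => Known Zer
    | Some s => Half k (sgn_flip f s)
    | None => Open
    end
  end.

(* The assigned signs, and the keys whose consequences are still to be drawn. *)
Definition state := (PM.t sgn * seq positive)%type.

Definition assign k s (sq : state) : option state :=
  let: (st, q) := sq in
  match PM.find k st with
  | None => Some (PM.add k s st, k :: q)
  | Some s' => if sgn_eqb s s' then Some sq else None
  end.

(** The third term is the unknown sign at [k] times the nonzero [u]; since [u] is its own inverse,
    the unknown sign is the forced one times [u]. *)
Definition infer_half s t k u (sq : state) : option state :=
  match forced s t with
  | Some r => assign k (sgn_mul r u) sq
  | None => Some sq
  end.

(** A sign is inferred only when two terms are known and the third lacks a single bracket; three
    known terms are tested for consistency. *)
Definition infer (g : relation) (sq : state) : option state :=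
  let: (t1, t2, t3) := g in
  match term_val sq.1 t1 with
  | Open => Some sq
  | Known s =>
    match term_val sq.1 t2 with
    | Open => Some sq
    | Known t =>
      match term_val sq.1 t3 with
      | Open => Some sq
      | Known u => if vanishing s t u then Some sq else None
      | Half k u => infer_half s t k u sq
      end
    | Half k u =>
      match term_val sq.1 t3 with
      | Known t => infer_half s t k u sq
      | _ => Some sq
      end
    end
  | Half k u =>
    match term_val sq.1 t2 with
    | Known s =>
      match term_val sq.1 t3 with
      | Known t => infer_half s t k u sq
      | _ => Some sq
      end
    | _ => Some sq
    end
  end.

(* Linked triples are nonzero because no four points are collinear. *)
Definition transfer s (kf : positive * bool) (sq : state) : option state :=
  match s with Zer => None | _ => assign kf.1 (sgn_flip kf.2 s) sq end.

Fixpoint ofold (A S : Type) (f : A -> S -> option S) (l : seq A) (s : S) :=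
  if l is a :: l' then
    if f a s is Some s' then ofold f l' s' else None
  else Some s.

Definition links := PM.t (seq (positive * bool)).

Definition process (lk : links) k (sq : state) : option state :=
  match PM.find k sq.1 with
  | None => Some sq
  | Some s =>
    match ofold (transfer s) (odflt [::] (PM.find k lk)) sq with
    | None => None
    | Some sq' => ofold infer (odflt [::] (PM.find k watched)) sq'
    end
  end.

Fixpoint propagate fuel (lk : links) (sq : state) : option (PM.t sgn) :=
  if fuel is fuel'.+1 then
    if sq.2 is k :: q then
      if process lk k (sq.1, q) is Some sq' then propagate fuel' lk sq'
      else None
    else Some sq.1
  else Some sq.1.

Definition block := (positive * seq (positive * (positive * bool)))%type.

(* If x is between v and w then vxy, xwy and vwy have the same orientation. *)
Definition siblings v w x y : seq (positive * (positive * bool)) :=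
  let: (k1, f1) := oriented_key v x y in
  let: (k2, f2) := oriented_key x w y in
  let: (k3, f3) := oriented_key v w y in
  let f12 := f1 (+) f2 in let f13 := f1 (+) f3 in let f23 := f2 (+) f3 in
  [:: (k1, (k2, f12)); (k2, (k1, f12)); (k1, (k3, f13)); (k3, (k1, f13));
      (k2, (k3, f23)); (k3, (k2, f23))].

Definition mkblock v w x : block :=
  ((oriented_key v x w).1,
   flatten [seq siblings v w x y | y <- labels & y \notin [:: v; w; x]]).

Definition link (lk : links) (e : positive * (positive * bool)) :=
  push lk e.1 e.2.

Definition transfer_link (e : positive * (positive * bool)) (sq : state) :=
  match PM.find e.1 sq.1 with
  | None => Some sq
  | Some s => transfer s e.2 sq
  end.

(* Each of the 120 keys is queued at most once, so the fuel does not run out;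
   soundness does not depend on this. *)
Definition add_block (b : block) (lk : links) (st : PM.t sgn) :=
  let lk' := foldl link lk b.2 in
  match assign b.1 Zer (st, [::]) with
  | None => None
  | Some sq =>
    match ofold transfer_link b.2 sq with
    | None => None
    | Some sq' =>
      match propagate 120 lk' sq' with
      | None => None
      | Some st' => Some (lk', st')
      end
    end
  end.

(* Each element of [es] lists the candidate blockers of one edge. *)
Fixpoint refute (es : seq (seq block)) (lk : links) (st : PM.t sgn) :=
  if es is opts :: es' then
    all (fun b => if add_block b lk st is Some (lk', st')
                  then refute es' lk' st' else true) opts
  else false.

(* The labels 0-2, 3-5, 6-8 are the three triangles and 9 is the single point. *)
Definition choices v w (l : seq nat) := [seq mkblock v w x | x <- l].
Definition colour i := i %/ 3.
Definition edge v w := choices v w [seq x <- labels | colour x != colour v].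

(** The search starts from orientations of the three triangles, most of which a relabelling can make
    positive beforehand. *)
Definition seeds (sa sb sc : sgn) :=
  PM.add (key 0 1 2) sa (PM.add (key 3 4 5) sb (PM.add (key 6 7 8) sc
    (PM.empty _))).

(* The order of the edges only affects the size of the search tree. *)
Definition shared_class_case :=
  [:: choices 0 1 [:: 3]; choices 0 2 [:: 4]; choices 3 4 [:: 0; 1; 2; 6; 9];
      edge 4 5; edge 3 5; edge 1 2; edge 6 8; edge 6 7; edge 7 8].

Definition last_point_case :=
  [:: choices 0 1 [:: 9]; choices 3 4 [:: 9]; choices 6 7 [:: 9];
      edge 7 8; edge 6 8; edge 3 5; edge 4 5; edge 1 2; edge 0 2].

(** * Soundness of the search with respect to an actual sign map *)

Section Soundness.
Variable chi : positive -> sgn.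

Definition term_sgn (t : term) :=
  let: (k, l, f) := t in sgn_flip f (sgn_mul (chi k) (chi l)).
Definition rel_ok (g : relation) :=
  let: (t1, t2, t3) := g in
  vanishing (term_sgn t1) (term_sgn t2) (term_sgn t3).
Definition link_ok k (lf : positive * bool) :=
  chi k <> Zer /\ chi lf.1 = sgn_flip lf.2 (chi k).
Definition block_ok (b : block) :=
  chi b.1 = Zer /\ List.Forall (fun e => link_ok e.1 e.2) b.2.
Definition agrees (st : PM.t sgn) :=
  forall k s, PM.find k st = Some s -> chi k = s.
Definition all_at (A : Type) (P : positive -> A -> Prop) (m : PM.t (seq A)) :=
  forall k, List.Forall (P k) (odflt [::] (PM.find k m)).

Lemma agrees_add st k s : agrees st -> chi k = s -> agrees (PM.add k s st).
Proof.
move=> ag ks j t; case: (PM.E.eq_dec k j) => [<-|nkj].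
  by rewrite PM.gss => -[<-].
by rewrite PM.gso => [|/esym//]; exact: ag.
Qed.

Lemma all_at_push A (P : positive -> A -> Prop) m k x :
  all_at P m -> P k x -> all_at P (push m k x).
Proof.
move=> Pm Px j; rewrite /push; case: (PM.E.eq_dec k j) => [<-|nkj].
  by rewrite PM.gss; constructor=> //; exact: Pm.
by rewrite PM.gso => [|/esym//]; exact: Pm.
Qed.

Lemma all_at_watched : List.Forall rel_ok relations ->
  all_at (fun=> rel_ok) watched.
Proof.
have: all_at (fun=> rel_ok) (PM.empty _) by move=> k; rewrite PM.gempty.
rewrite /watched; elim: relations (PM.empty _) => [|g gs IH] m //= mP.
case/List.Forall_cons_iff => gP /(IH _); apply.
by case: g gP => [[[[k1 k2] f] [[k3 k4] f']] [[k5 k6] f'']] gP;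
  do !apply: all_at_push.
Qed.

(** Soundness takes this positive form throughout: steps justified by facts true of [chi] never
    return [None], so a conflict shows that no such sign map exists. *)
Lemma ofoldP A S (P : A -> Prop) (I : S -> Prop) (f : A -> S -> option S) l s :
    (forall a s, P a -> I s -> exists2 s', f a s = Some s' & I s') ->
  List.Forall P l -> I s -> exists2 s', ofold f l s = Some s' & I s'.
Proof.
move=> fP; elim: l s => [|a l IH] s /=; first by exists s.
by case/List.Forall_cons_iff => Pa Pl /(fP _ _ Pa)[s' -> /(IH _ Pl)].
Qed.

Lemma assignP k s sq : agrees sq.1 -> chi k = s ->
  exists2 sq', assign k s sq = Some sq' & agrees sq'.1.
Proof.
case: sq => st q /= ag ks; case E: PM.find => [s'|].
  by move/ag: E; rewrite ks => ->; case: s' => /=; eexists.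
by eexists; [reflexivity | exact: agrees_add].
Qed.

Lemma term_valP st t : agrees st ->
  match term_val st t with
  | Known s => term_sgn t = s
  | Half k u => u <> Zer /\ term_sgn t = sgn_mul (chi k) u
  | Open => True
  end.
Proof.
case: t => [[k l] f] ag /=.
case Ek: (PM.find k st) => [s|]; case El: (PM.find l st) => [s'|] //;
  try move/ag: Ek => ->; try move/ag: El => ->; try case: s => //; try case: s' => //;
  try case: (chi k) => //; try case: (chi l); by case: f.
Qed.

Lemma infer_halfP s t k u sq v : agrees sq.1 -> u <> Zer ->
    vanishing s t v -> v = sgn_mul (chi k) u ->
  exists2 sq', infer_half s t k u sq = Some sq' & agrees sq'.1.
Proof.
move=> ag u0 van vE; rewrite /infer_half; case E: forced => [r|]; last by exists sq.
apply: assignP => //; move: van vE E u0.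
by case: s; case: t; case: v => //=; case: (chi k); case: u => //= _ _ [<-].
Qed.

Lemma inferP g sq : rel_ok g -> agrees sq.1 ->
  exists2 sq', infer g sq = Some sq' & agrees sq'.1.
Proof.
case: g => [[t1 t2] t3] /= van ag.
move: (term_valP t1 ag) (term_valP t2 ag) (term_valP t3 ag).
case: term_val => [s1|k1 u1|]; last by exists sq.
  case: term_val => [s2|k2 u2|]; last by exists sq.
    case: term_val => [s3|k3 u3|]; last by exists sq.
      by move=> <- <- <-; rewrite van; exists sq.
    by move=> <- <- [u0 e]; exact: (infer_halfP ag u0 van e).
  case: term_val => [s3|k3 u3|]; try by exists sq.
  move=> <- [u0 e] <-; apply: (infer_halfP ag u0 _ e).
  by move: van; case: term_sgn; case: term_sgn; case: term_sgn.
case: term_val => [s2|k2 u2|]; try by exists sq.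
case: term_val => [s3|k3 u3|]; try by exists sq.
move=> [u0 e] <- <-; apply: (infer_halfP ag u0 _ e).
by move: van; case: term_sgn; case: term_sgn; case: term_sgn.
Qed.

Lemma transferP s k lf sq : chi k = s -> link_ok k lf -> agrees sq.1 ->
  exists2 sq', transfer s lf sq = Some sq' & agrees sq'.1.
Proof.
move=> <- [k0 lk] ag; rewrite /transfer.
by case E: (chi k) lk k0 => // lk _; exact: assignP.
Qed.

Hypothesis rels_ok : List.Forall rel_ok relations.

Lemma processP lk k sq : all_at link_ok lk -> agrees sq.1 ->
  exists2 sq', process lk k sq = Some sq' & agrees sq'.1.
Proof.
move=> lkP ag; rewrite /process; case E: PM.find => [s|]; last by exists sq.
move/ag: E => ks.
have [sq' -> ag'] := ofoldP (fun lf sq => @transferP s k lf sq ks) (lkP k) ag.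
by apply: (ofoldP inferP _ ag'); exact: all_at_watched.
Qed.

Lemma propagateP fuel lk sq : all_at link_ok lk -> agrees sq.1 ->
  exists2 st, propagate fuel lk sq = Some st & agrees st.
Proof.
move=> lkP; elim: fuel sq => [|n IH] [st [|k q]] ag /=; try by exists st.
have [sq' -> /IH//] := processP k lkP (ag : agrees (st, q).1).
Qed.

Lemma add_blockP b lk st : block_ok b -> all_at link_ok lk -> agrees st ->
  exists2 r, add_block b lk st = Some r & all_at link_ok r.1 /\ agrees r.2.
Proof.
case=> b0 bP lkP ag; rewrite /add_block.
have lkP' : all_at link_ok (foldl link lk b.2).
  elim: (b.2) lk lkP bP => [|e l IH] lk lkP //=.
  by case/List.Forall_cons_iff => eP; apply: IH; exact: all_at_push.
have [sq -> ag1] := assignP (sq := (st, [::])) ag b0.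
have step e sq1 : link_ok e.1 e.2 -> agrees sq1.1 ->
    exists2 sq', transfer_link e sq1 = Some sq' & agrees sq'.1.
  move=> eP ag'; rewrite /transfer_link; case E: PM.find => [s|]; last by exists sq1.
  by move/ag': E => ks; exact: transferP eP ag'.
have [sq' -> ag2] := ofoldP step bP ag1.
have [st' -> ag3] := propagateP 120 lkP' ag2.
by eexists.
Qed.

(** On the branch that picks a true block for each edge no conflict arises, so the recursion reaches
    the empty list, where the search answers [false]. *)
Lemma refuteP es lk st :
    List.Forall (fun opts => exists2 b, List.In b opts & block_ok b) es ->
  all_at link_ok lk -> agrees st -> refute es lk st = false.
Proof.
elim: es lk st => [|opts es IH] lk st //= /List.Forall_cons_iff[[b bo bP] esP].
move=> lkP ag; elim: opts bo => [//|b' opts IHo] /= [->|/IHo ->]; last exact: andbF.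
by have [[lk' st'] -> [lkP' ag']] := add_blockP bP lkP ag; rewrite IH.
Qed.

End Soundness.

Import Order.TTheory GRing.Theory Num.Theory.

Local Open Scope fset_scope.
Local Open Scope ring_scope.

(** * Orientations in the plane *)

Definition sgnr (R : realDomainType) (x : R) : sgn :=
  if x == 0 then Zer else if 0 < x then Pos else Neg.

Lemma sgnrN (R : realDomainType) (x : R) : sgnr (- x) = sgn_neg (sgnr x).
Proof. by rewrite /sgnr oppr_eq0 oppr_gt0; case: ltrgt0P. Qed.

Lemma sgnrM (R : realDomainType) (x y : R) :
  sgnr (x * y) = sgn_mul (sgnr x) (sgnr y).
Proof.
rewrite /sgnr mulf_eq0.
case: (ltrgt0P x) => [x0|x0|->]; case: (ltrgt0P y) => [y0|y0|->] //=;
  rewrite ?(pmulr_rgt0 _ x0) ?(nmulr_rgt0 _ x0) ?y0 //.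
- by rewrite ltNge ltW.
- by rewrite ltNge ltW.
Qed.

Lemma sgnr_pmull (R : realDomainType) (x y : R) : 0 < x -> sgnr (x * y) = sgnr y.
Proof. by move=> x0; rewrite sgnrM {1}/sgnr gt_eqF x0. Qed.

Lemma sgnr_vanishing (R : realDomainType) (x y z : R) : x + y + z = 0 ->
  vanishing (sgnr x) (sgnr y) (sgnr z).
Proof.
rewrite /sgnr => e.
by case: (ltrgt0P x) => x0; case: (ltrgt0P y) => y0; case: (ltrgt0P z) => z0 //;
  lra.
Qed.

Section Geometry.
Variable R : realType.
Implicit Types u v w x y : 'rV[R]_2.

Definition det3 u v w : R :=
  (v 0 0 - u 0 0) * (w 0 1 - u 0 1) - (v 0 1 - u 0 1) * (w 0 0 - u 0 0).

Lemma det3C u v w : det3 v u w = - det3 u v w.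
Proof. by rewrite /det3; ring. Qed.

Lemma det3_rot u v w : det3 v w u = det3 u v w.
Proof. by rewrite /det3; ring. Qed.

Lemma grassmann_pluecker u v w x y :
  det3 u v w * det3 u x y + - (det3 u v x * det3 u w y) + det3 u v y * det3 u w x = 0.
Proof. by rewrite /det3; ring. Qed.

Lemma row2P u v : u 0 0 = v 0 0 -> u 0 1 = v 0 1 -> u = v.
Proof.
move=> e0 e1; apply/rowP => i; case: (unliftP ord0 i) => [j|] ->; rewrite ?e0 //.
by rewrite (_ : lift _ _ = 1) ?e1 //; apply: val_inj; rewrite /= (ord1 j).
Qed.

(** [x] cuts the segment in the ratio [t : 1 - t], and likewise the triangle over it with apex
    [y]. *)
Lemma blocks_det3 x v w : blocks x v w ->
  exists2 t, 0 < t < 1 & forall y,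
    [/\ det3 v x w = 0, det3 v x y = t * det3 v w y &
        det3 x w y = (1 - t) * det3 v w y].
Proof.
case=> t [t01 ->]; exists t => // y.
by rewrite /det3 !mxE; split; ring.
Qed.

Lemma blocks_sgnr x v w y : blocks x v w ->
  sgnr (det3 v x y) = sgnr (det3 v w y) /\
  sgnr (det3 x w y) = sgnr (det3 v w y).
Proof.
case/blocks_det3 => t /andP[t0 t1] /(_ y)[_ -> ->].
by rewrite !sgnr_pmull ?subr_gt0.
Qed.

Lemma blocks_sym x v w : blocks x v w -> blocks x w v.
Proof.
case=> t [/andP[t0 t1] ->]; exists (1 - t); split; first by apply/andP; split; lra.
by rewrite addrC; congr (_ *: _ + _); ring.
Qed.

Definition line_point u v (r : R) := u + r *: (v - u).

Lemma line_point_blocks u v (a b c : R) : a < b < c ->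
  blocks (line_point u v b) (line_point u v a) (line_point u v c).
Proof.
case/andP => ab bc; have ac : 0 < c - a by lra.
exists ((b - a) / (c - a)); split.
  apply/andP; split; first by rewrite divr_gt0 //; lra.
  by rewrite ltr_pdivrMr //; lra.
by apply: row2P; rewrite !mxE; field; rewrite gt_eqF.
Qed.

Lemma det3_0_line_point u v w : u != v -> det3 u v w = 0 ->
  exists r, w = line_point u v r.
Proof.
move=> uv; rewrite /det3 => e.
(* The parameter is a quotient of coordinate differences; on a vertical line it must come from the
   second coordinate. *)
have [e0|n0] := eqVneq (v 0 0 - u 0 0) 0.
  have n1 : v 0 1 - u 0 1 != 0.
    apply: contra_neq uv => e1.
    by apply: row2P; apply/esym/eqP; rewrite -subr_eq0 (e0, e1).
  exists ((w 0 1 - u 0 1) / (v 0 1 - u 0 1)).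
  move: e; rewrite e0 mul0r sub0r => /eqP.
  rewrite oppr_eq0 mulf_eq0 (negPf n1) /= => /eqP e.
  by apply: row2P; rewrite !mxE ?e0 ?mulr0 ?addr0; [lra | field].
exists ((w 0 0 - u 0 0) / (v 0 0 - u 0 0)).
apply: row2P; rewrite !mxE; first by field.
apply: (mulfI n0); rewrite mulrDr mulrA [_ * (_ / _)]mulrC divfK //; lra.
Qed.

End Geometry.

(** * Labelled ten-point configurations *)

Lemma Forall_flatten (T : eqType) (A : Type) (P : A -> Prop) (f : T -> seq A) l :
  (forall y, y \in l -> List.Forall P (f y)) ->
  List.Forall P (flatten [seq f y | y <- l]).
Proof.
elim: l => [|y l IH] fP /=; first by constructor.
apply/List.Forall_app; split; first by apply: fP; rewrite mem_head.
by apply: IH => z zl; apply: fP; rewrite in_cons zl orbT.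
Qed.

Lemma Forall_map (T : eqType) (A : Type) (P : A -> Prop) (f : T -> A) l :
  (forall y, y \in l -> P (f y)) -> List.Forall P [seq f y | y <- l].
Proof.
elim: l => [|y l IH] fP /=; constructor; first by apply: fP; rewrite mem_head.
by apply: IH => z zl; apply: fP; rewrite in_cons zl orbT.
Qed.

Definition triples : seq (nat * nat * nat) :=
  flatten [seq flatten [seq [seq (i, j, k) | i <- iota 0 j] | j <- iota 0 k]
    | k <- labels].

(** Inverse of [key]: [triples] runs in colexicographic order, and keys start at 1 while positions
    start at 0. *)
Definition triple (q : positive) := nth (0, 0, 0)%N triples (Pos.to_nat q).-1.

Lemma mem_labels i : (i \in labels) = (i < 10)%N.
Proof. exact: mem_iota. Qed.

Lemma triple_key i j k : (i < j < k)%N -> (k < 10)%N -> triple (key i j k) = (i, j, k).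
Proof.
have /allP H : all (fun k => all (fun j => all (fun i =>
  triple (key i j k) == (i, j, k)) (iota 0 j)) (iota 0 k)) labels by vm_compute.
case/andP => ij jk; rewrite -mem_labels => /H /allP /(_ j).
rewrite mem_iota jk => /(_ isT) /allP /(_ i).
by rewrite mem_iota ij => /(_ isT) /eqP.
Qed.

Lemma colour_pigeonhole a b c d : uniq [:: a; b; c; d] ->
    (a < 10)%N -> (b < 10)%N -> (c < 10)%N -> (d < 10)%N ->
  colour a = colour b -> colour a = colour c -> colour a = colour d -> False.
Proof.
have /allP H : all (fun a => all (fun b => all (fun c => all (fun d =>
    uniq [:: a; b; c; d] ==> ~~ [&& colour a == colour b, colour a == colour c &
      colour a == colour d]) labels) labels) labels) labels by vm_compute.
rewrite -!mem_labels => u ia ib ic id eab eac ead; move: u.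
move: (H a ia) => /allP /(_ b ib) /allP /(_ c ic) /allP /(_ d id) /implyP h /h.
by rewrite eab -eac -ead eab !eqxx.
Qed.

Section Labelled.
Variable R : realType.
Implicit Types p : nat -> 'rV[R]_2.

(** A blocked set of type 3, 3, 3, 1 listed class by class: [colour] is 0, 1, 2 on the triangles and
    3 on label 9. *)
Definition labelled p :=
  [/\ forall i j, (i < 10)%N -> (j < 10)%N -> p i = p j -> i = j,
      forall i j, (i < 10)%N -> (j < 10)%N -> i != j -> colour i = colour j ->
        exists2 x, (x < 10)%N & blocks (p x) (p i) (p j) &
      forall i j x, (i < 10)%N -> (j < 10)%N -> (x < 10)%N ->
        blocks (p x) (p i) (p j) -> colour i = colour j].

Definition det_at p i j k := det3 (p i) (p j) (p k).
Definition chi p (q : positive) :=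
  let: (i, j, k) := triple q in sgnr (det_at p i j k).

Lemma chi_oriented_key p a b c : (a < 10)%N -> (b < 10)%N -> (c < 10)%N ->
    a != b -> a != c -> b != c ->
  chi p (oriented_key a b c).1 = sgn_flip (oriented_key a b c).2 (sgnr (det_at p a b c)).
Proof.
move=> ia ib ic; rewrite /oriented_key => ab ac bc.
have [lab|lab|eab] := ltngtP a b; last by rewrite eab eqxx in ab.
all: have [lac|lac|eac] := ltngtP a c; last by rewrite eac eqxx in ac.
all: have [lbc|lbc|ebc] := ltngtP b c; last by rewrite ebc eqxx in bc.
all: try lia; rewrite /chi triple_key ?lab ?lac ?lbc //= /det_at -?sgnrN.
all: by congr (sgnr _); rewrite /det3; ring.
Qed.

Lemma term_sgn_bracket_product p f a b c d e :
    all (gtn 10) [:: a; b; c; d; e] -> uniq [:: a; b; c] -> uniq [:: a; d; e] ->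
  term_sgn (chi p) (bracket_product f a b c d e) =
  sgn_flip f (sgnr (det_at p a b c * det_at p a d e)).
Proof.
rewrite /= !inE !negb_or !andbT.
move=> /and5P[ia ib ic id ie] /andP[/andP[ab ac] bc] /andP[/andP[ad ae] de].
rewrite /bracket_product sgnrM.
have := chi_oriented_key p ia ib ic ab ac bc; have := chi_oriented_key p ia id ie ad ae de.
case: (oriented_key a b c) => k s; case: (oriented_key a d e) => l t /= -> ->.
by case: f; case: s; case: t; case: sgnr; case: sgnr.
Qed.

Lemma chi_relations p : List.Forall (rel_ok (chi p)) relations.
Proof.
rewrite /relations; apply: Forall_flatten => a; rewrite mem_labels => ia.
apply: Forall_flatten => b; rewrite mem_filter mem_labels => /andP[ba ib].
apply: Forall_flatten => c; rewrite mem_filter mem_labels => /andP[/andP[bc ca] ic].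
apply: Forall_flatten => d; rewrite mem_filter mem_labels => /andP[/andP[cd da] id].
apply: Forall_map => e; rewrite mem_filter mem_labels => /andP[/andP[de ea] ie].
have ab : a != b by rewrite eq_sym.
have [ac ad ae] : [/\ a != c, a != d & a != e] by rewrite ![a == _]eq_sym.
have [nbc nbd nbe] : [/\ b != c, b != d & b != e] by split; lia.
have [ncd nce nde] : [/\ c != d, c != e & d != e] by split; lia.
have ndc : d != c by rewrite eq_sym.
rewrite /rel_ok /pluecker_relation !term_sgn_bracket_product /= ?inE ?negb_or ?ia ?ib ?ic ?id ?ie
  ?ab ?ac ?ad ?ae ?nbc ?nbd ?nbe ?ncd ?nce ?nde ?ndc //=.
by rewrite -sgnrN; apply: sgnr_vanishing; exact: grassmann_pluecker.
Qed.

(* Of four points p < q < r < s on a line, p, r and q, s and p, s are separated by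
   another one, so all four have the same colour. *)
Lemma labelled_four_collinear p i j k l :
    labelled p -> all (gtn 10) [:: i; j; k; l] -> uniq [:: i; j; k; l] ->
  det_at p i j k = 0 -> det_at p i j l = 0 -> False.
Proof.
case=> pI _ pC /= /and5P[ii ij ik il _] u dk dl.
have nij : i != j by move: u; rewrite /= !inE; lia.
have pij : p i != p j by apply: contra_neq nij; exact: pI.
(* Position along the line through [p i] and [p j], by orthogonal projection; an explicit formula in
   [m] allows sorting the labels by it. *)
pose r m := ((p m 0 0 - p i 0 0) * (p j 0 0 - p i 0 0) +
             (p m 0 1 - p i 0 1) * (p j 0 1 - p i 0 1)) /
            ((p j 0 0 - p i 0 0) ^+ 2 + (p j 0 1 - p i 0 1) ^+ 2).
have d0 : (p j 0 0 - p i 0 0) ^+ 2 + (p j 0 1 - p i 0 1) ^+ 2 != 0.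
  apply: contra_neq pij => /eqP; rewrite paddr_eq0 ?sqr_ge0 // !sqrf_eq0 !subr_eq0.
  by case/andP=> /eqP e0 /eqP e1; exact: row2P.
have rE m t : p m = line_point (p i) (p j) t -> p m = line_point (p i) (p j) (r m).
  by move=> e; rewrite {1}e; congr (line_point _ _ _); rewrite /r e !mxE; field.
have on m : m \in [:: i; j; k; l] -> p m = line_point (p i) (p j) (r m).
  rewrite !inE => /or4P[]/eqP->.
  - by apply: (rE _ 0); apply: row2P; rewrite !mxE; ring.
  - by apply: (rE _ 1); apply: row2P; rewrite !mxE; ring.
  - by have [t] := det3_0_line_point pij dk; exact: rE.
  - by have [t] := det3_0_line_point pij dl; exact: rE.
pose s := sort (fun a b => r a <= r b) [:: i; j; k; l].
have ps : perm_eq s [:: i; j; k; l] by rewrite perm_sort.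
have sp m : m \in s -> (m < 10)%N.
  by rewrite (perm_mem ps) !inE => /or4P[]/eqP->.
have : sorted (fun a b => r a <= r b) s by apply: sort_sorted => a b; exact: le_total.
have us : uniq s by rewrite (perm_uniq ps).
have rI : {in s &, injective r}.
  move=> a b sa sb e; apply: pI; rewrite ?sp // on -?(perm_mem ps) // e -on //.
  by rewrite -(perm_mem ps).
have ons m : m \in s -> p m = line_point (p i) (p j) (r m).
  by rewrite (perm_mem ps); exact: on.
have := perm_size ps.
case: s us {ps on} sp rI ons => [|a [|b [|c [|d []]]]] // us sp rI ons _ /=.
case/and4P => ab bc cd _.
have lt m n : m \in [:: a; b; c; d] -> n \in [:: a; b; c; d] ->
    m != n -> r m <= r n -> r m < r n.
  move=> im in_ mn le; rewrite lt_neqAle le andbT.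
  by apply: contra_neq mn; exact: rI.
have [ia [ib [ic id]]] : a \in [:: a; b; c; d] /\ b \in [:: a; b; c; d] /\
   c \in [:: a; b; c; d] /\ d \in [:: a; b; c; d] by rewrite !inE !eqxx !orbT.
have u4 := us; move: us; rewrite /= !inE !negb_or !andbT => /and3P[/and3P[nab _ _] /andP[nbc _] ncd].
have {}ab := lt a b ia ib nab ab; have {}bc := lt b c ib ic nbc bc.
have {}cd := lt c d ic id ncd cd.
have same m n q : m \in [:: a; b; c; d] -> n \in [:: a; b; c; d] ->
    q \in [:: a; b; c; d] -> r m < r n < r q -> colour m = colour q.
  move=> im in_ iq mnq; apply: (pC _ _ n); rewrite ?sp //.
  by rewrite (ons m) // (ons n) // (ons q) //; exact: line_point_blocks.
have e1 := same a b c ia ib ic; rewrite ab bc in e1.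
have e2 := same b c d ib ic id; rewrite bc cd in e2.
have e3 := same a b d ia ib id; rewrite ab (lt_trans bc cd) in e3.
have {}e1 := e1 isT; have {}e2 := e2 isT; have {}e3 := e3 isT.
by apply: (colour_pigeonhole u4 (sp _ ia) (sp _ ib) (sp _ ic) (sp _ id));
  rewrite // e3 -e2.
Qed.
End Labelled.

(** * The two refuted configurations, and relabelling *)

Lemma shared_class_refuted s : s <> Zer ->
  refute shared_class_case (PM.empty _) (seeds Pos s Pos) = true.
Proof. by case: s => [_|[]//|_]; vm_cast_no_check (erefl true). Qed.

Lemma last_point_refuted : refute last_point_case (PM.empty _) (seeds Pos Pos Pos) = true.
Proof. vm_cast_no_check (erefl true). Qed.

Definition colour_class c : seq nat := [:: 3 * c; 3 * c + 1; 3 * c + 2]%N.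

(** Symmetries of the partition into colours; the colours themselves may be permuted. *)
Definition relabelling (s : seq nat) :=
  perm_eq s labels &&
  all (fun i => all (fun j =>
    (colour (nth 0%N s i) == colour (nth 0%N s j)) == (colour i == colour j))
    labels) labels.

(** Verified by computation on all 6^4 choices of an order of the triangles and an order within
    each. *)
Lemma relabelling_blocks a b c s t u :
    perm_eq [:: a; b; c] [:: 0; 1; 2]%N -> perm_eq s (colour_class a) ->
    perm_eq t (colour_class b) -> perm_eq u (colour_class c) ->
  relabelling (s ++ t ++ u ++ [:: 9%N]).
Proof.
have /allP H : all (fun abc => let a := nth 0%N abc 0 in let b := nth 0%N abc 1 in
    let c := nth 0%N abc 2 in
    all (fun s => all (fun t => all (fun u => relabelling (s ++ t ++ u ++ [:: 9%N]))
      (permutations (colour_class c))) (permutations (colour_class b)))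
      (permutations (colour_class a)))
    (permutations [:: 0; 1; 2]%N) by vm_compute.
by rewrite -!mem_permutations => /H/= /allP h /h /allP {}h /h /allP; apply.
Qed.

Lemma colour_class_third x y : (x < 9)%N -> (y < 9)%N -> x != y -> colour x = colour y ->
  exists z, perm_eq [:: x; y; z] (colour_class (colour x)).
Proof.
move=> ix iy xy e; exists (9 * colour x + 3 - x - y)%N.
have /allP H : all (fun x => all (fun y => (x != y) && (colour x == colour y) ==>
    perm_eq [:: x; y; (9 * colour x + 3 - x - y)%N] (colour_class (colour x))) (iota 0 9))
    (iota 0 9) by vm_compute.
move: (H x); rewrite mem_iota => /(_ ix) /allP /(_ y); rewrite mem_iota => /(_ iy).
by rewrite xy e eqxx.
Qed.

Section Blocks.
Variable R : realType.
Implicit Types x y v w : 'rV[R]_2.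

Lemma blocks_neq x v w : blocks x v w -> v != w -> x != v.
Proof.
case=> t [/andP[t0 _] ->]; apply: contra_neq => e.
have n0 : t != 0 by rewrite gt_eqF.
have := congr1 (fun u : 'rV[R]_2 => u 0 0) e; have := congr1 (fun u : 'rV[R]_2 => u 0 1) e.
rewrite !mxE => e1 e0.
by apply: row2P; apply: (mulfI n0); lra.
Qed.

Lemma blocks_antisym v w x : blocks x v w -> blocks w v x -> v = w.
Proof.
case=> t [/andP[t0 t1] xE] [u [/andP[u0 u1] wE]].
(* Substituting one relation into the other gives [w - v = u t (w - v)] with [u t < 1]. *)
have n0 : 1 - u * t != 0 by rewrite gt_eqF //; nra.
have := congr1 (fun u : 'rV[R]_2 => u 0 0) wE; have := congr1 (fun u : 'rV[R]_2 => u 0 1) wE.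
rewrite xE !mxE => e1 e0.
by apply: row2P; apply: (mulfI n0); lra.
Qed.

End Blocks.

Section Labelled.
Variable R : realType.
Implicit Types p : nat -> 'rV[R]_2.

Lemma labelled_relabel p s : labelled p -> relabelling s ->
  labelled (fun i => p (nth 0%N s i)).
Proof.
case=> pI pB pC /andP[ps /allP sC].
have ss : size s = 10%N by rewrite (perm_size ps).
have us : uniq s by rewrite (perm_uniq ps).
have s10 i : (i < 10)%N -> (nth 0%N s i < 10)%N.
  by move=> i10; rewrite -mem_labels -(perm_mem ps) mem_nth ?ss.
have cs i j : (i < 10)%N -> (j < 10)%N ->
    (colour (nth 0%N s i) == colour (nth 0%N s j)) = (colour i == colour j).
  rewrite -!mem_labels => ii ij.
  by exact: (eqP (allP (sC i ii) j ij)).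
split=> [i j ii ij e|i j ii ij nij e|i j x ii ij ix b].
- by apply/eqP; rewrite -(nth_uniq 0%N _ _ us) ?ss //; apply/eqP/pI; rewrite ?s10.
- have [||||x ix b] := pB (nth 0%N s i) (nth 0%N s j); rewrite ?s10 //.
  + by rewrite nth_uniq ?ss.
  + by apply/eqP; rewrite cs // e.
  have xs : x \in s by rewrite (perm_mem ps) mem_labels.
  by exists (index x s); [rewrite -ss index_mem | rewrite nth_index].
- by apply/eqP; rewrite -cs // (pC _ _ _ _ _ _ b) ?s10.
Qed.

(** If the blocker [x] had the colour of [i], some [y] would block [i] and [x], and [i], [x], [j],
    [y] would be four collinear points. *)
Lemma labelled_blocker p i j : labelled p -> (i < 10)%N -> (j < 10)%N -> i != j ->
  colour i = colour j ->
  exists x, [/\ (x < 10)%N, colour x != colour i & blocks (p x) (p i) (p j)].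
Proof.
move=> L ii ij nij cij; have [pI pB pC] := L.
have neq m n : (m < 10)%N -> (n < 10)%N -> m != n -> p m != p n.
  by move=> im in_; apply: contra_neq; exact: pI.
have [x ix b] := pB _ _ ii ij nij cij; exists x; split=> //.
apply/eqP => cx.
have xi : x != i by apply/eqP => e; move: (blocks_neq b (neq _ _ ii ij nij)); rewrite e eqxx.
have xj : x != j.
  apply/eqP => e; have nji : j != i by rewrite eq_sym.
  by move: (blocks_neq (blocks_sym b) (neq _ _ ij ii nji)); rewrite e eqxx.
have [y iy b'] := pB _ _ ix ii xi cx.
have yx : y != x by apply/eqP => e; move: (blocks_neq b' (neq _ _ ix ii xi)); rewrite e eqxx.
have nix : i != x by rewrite eq_sym.
have yi : y != i.
  by apply/eqP => e; move: (blocks_neq (blocks_sym b') (neq _ _ ii ix nix)); rewrite e eqxx.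
have yj : y != j.
  apply/eqP => e; move: b'; rewrite e => /blocks_sym /(blocks_antisym b) eij.
  by move: nij; rewrite (pI _ _ ii ij eij) eqxx.
apply: (@labelled_four_collinear R p i x j y) => //=.
- by rewrite ii ij ix iy.
- by rewrite !inE !negb_or eq_sym xi nij (eq_sym i y) yi xj (eq_sym x y) yx (eq_sym j y) yj.
- by case/blocks_det3: b => t _ /(_ (p i))[].
- case/blocks_det3: b' => t _ /(_ (p i))[+ _ _]; rewrite /det_at => e.
  by rewrite -[RHS]e /det3; ring.
Qed.

(** A collinear class together with a blocker of another colour would give four collinear points. *)
Lemma labelled_class_det p i j k : labelled p -> (i < 10)%N -> (j < 10)%N -> (k < 10)%N ->
  uniq [:: i; j; k] -> colour i = colour j -> colour i = colour k ->
  det_at p i j k != 0.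
Proof.
move=> L ii ij ik u cij cik; apply/eqP => d.
move: (u); rewrite /= !inE negb_or andbT => /andP[/andP[nij nik] njk].
have [x [ix cx b]] := labelled_blocker L ii ij nij cij.
apply: (@labelled_four_collinear R p i j k x) => //.
- by rewrite /= ii ij ik ix.
- rewrite -[[:: i; j; k; x]]/([:: i; j; k] ++ [:: x]) cat_uniq u /= orbF andbT !inE.
  by apply: contra cx => /or3P[]/eqP->; rewrite ?cij ?cik // -?cij -?cik.
- case/blocks_det3: b => t _ /(_ (p i))[+ _ _]; rewrite /det_at => e.
  by apply/eqP; rewrite -oppr_eq0 -e /det3; apply/eqP; ring.
Qed.

Lemma mkblock_ok p v w x : labelled p -> (v < 10)%N -> (w < 10)%N -> (x < 10)%N ->
  v != w -> blocks (p x) (p v) (p w) -> block_ok (chi p) (mkblock v w x).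
Proof.
move=> L iv iw ix vw b; have [pI _ _] := L.
have pvw : p v != p w by apply: contra_neq vw; exact: pI.
have vx : v != x by apply/eqP => e; move: (blocks_neq b pvw); rewrite e eqxx.
have xw : x != w.
  apply/eqP => e; rewrite eq_sym in pvw.
  by move: (blocks_neq (blocks_sym b) pvw); rewrite e eqxx.
have d0 : det_at p v x w = 0 by case/blocks_det3: b => t _ /(_ (p v))[].
split; first by rewrite /mkblock /= chi_oriented_key // d0 /sgnr eqxx; case: (_.2).
apply: Forall_flatten => y; rewrite mem_filter mem_labels !inE !negb_or.
case/andP => /and3P[yv yw yx] iy; rewrite ![y == _]eq_sym in yv yw yx.
have [e1 e2] := blocks_sgnr (p y) b.
(* Otherwise [y] would be a fourth point on the line; this is the nonvanishing that [link_ok]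
   demands. *)
have n0 : sgnr (det_at p v w y) <> Zer.
  rewrite /sgnr; case: eqP => [e|_]; last by case: ifP.
  move=> _; apply: (@labelled_four_collinear R p v w x y) => //=.
  - by rewrite iv iw ix iy.
  - by rewrite !inE !negb_or vw vx yv (eq_sym w x) xw yw yx.
  - by apply/eqP; rewrite -oppr_eq0 -d0 /det_at /det3; apply/eqP; ring.
have := chi_oriented_key p iv ix iy vx yv yx; have := chi_oriented_key p ix iw iy xw yx yw.
have := chi_oriented_key p iv iw iy vw yv yw.
rewrite /siblings /det_at e1 e2 /link_ok.
case: (oriented_key v x y) => k1 f1; case: (oriented_key x w y) => k2 f2.
case: (oriented_key v w y) => k3 f3 /=.
move: n0; rewrite /det_at; case: sgnr => // _ E3 E2 E1; do !constructor => /=;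
  rewrite ?E1 ?E2 ?E3; by case: (f1); case: (f2); case: (f3).
Qed.

Lemma In_map (f : nat -> block) x l : x \in l -> List.In (f x) [seq f y | y <- l].
Proof.
elim: l => //= y l IH; rewrite in_cons => /orP[/eqP->|/IH]; by [left|right].
Qed.

Lemma edge_ok p v w : labelled p -> (v < 10)%N -> (w < 10)%N -> v != w ->
  colour v = colour w -> exists2 b, List.In b (edge v w) & block_ok (chi p) b.
Proof.
move=> L iv iw vw cvw; have [x [ix cx b]] := labelled_blocker L iv iw vw cvw.
exists (mkblock v w x); last exact: mkblock_ok.
by apply: In_map; rewrite mem_filter mem_labels cx.
Qed.

Lemma choices_ok p v w x l : labelled p -> (v < 10)%N -> (w < 10)%N -> (x < 10)%N ->
  v != w -> blocks (p x) (p v) (p w) -> x \in l ->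
  exists2 b, List.In b (choices v w l) & block_ok (chi p) b.
Proof.
by move=> *; exists (mkblock v w x); [exact: In_map | exact: mkblock_ok].
Qed.

Lemma seeds_ok p : agrees (chi p)
  (seeds (sgnr (det_at p 0 1 2)) (sgnr (det_at p 3 4 5)) (sgnr (det_at p 6 7 8))).
Proof. by do 3!apply: agrees_add => //; move=> k s; rewrite PM.gempty. Qed.

Lemma labelled_refute p es : labelled p ->
    List.Forall (fun opts => exists2 b, List.In b opts & block_ok (chi p) b) es ->
  refute es (PM.empty _) (seeds (sgnr (det_at p 0 1 2)) (sgnr (det_at p 3 4 5))
    (sgnr (det_at p 6 7 8))) = false.
Proof.
move=> L esP; have l0 : all_at (link_ok (chi p)) (PM.empty _) by move=> k; rewrite PM.gempty.
exact: (refuteP (chi_relations p) esP l0 (@seeds_ok p)).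
Qed.

Lemma sgnr_gt0 (x : R) : 0 < x -> sgnr x = Pos.
Proof. by move=> x0; rewrite /sgnr gt_eqF ?x0. Qed.

Lemma sgnr_neq0 (x : R) : x != 0 -> sgnr x <> Zer.
Proof. by rewrite /sgnr => /negPf->; case: ifP. Qed.

Definition shared_class p :=
  [/\ labelled p, blocks (p 3) (p 0) (p 1) & blocks (p 4) (p 0) (p 2)]%N.

Lemma shared_class_oriented p z : shared_class p -> 0 < det_at p 0 1 2 -> 0 < det_at p 6 7 8 ->
  z \in [:: 0; 1; 2; 6; 9]%N -> blocks (p z) (p 3%N) (p 4%N) -> False.
Proof.
case=> L b3 b4 d0 d6 iz bz.
have z10 : (z < 10)%N by move: iz; rewrite !inE => /or4P[||| /orP[]] /eqP->.
(* This sign stays free: orienting the first triangle uses up the symmetry that swaps 1 with 2 and 3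
   with 4, so both values are searched. *)
have n3 : sgnr (det_at p 3 4 5) <> Zer by apply/sgnr_neq0/labelled_class_det.
have esP : List.Forall (fun opts =>
    exists2 b, List.In b opts & block_ok (chi p) b) shared_class_case.
  apply: List.Forall_cons; first exact: (@choices_ok p 0 1 3).
  apply: List.Forall_cons; first exact: (@choices_ok p 0 2 4).
  apply: List.Forall_cons; first exact: (@choices_ok p 3 4 z).
  by do 6!(apply: List.Forall_cons; first exact: edge_ok); exact: List.Forall_nil.
have := labelled_refute L esP.
by rewrite (sgnr_gt0 d0) (sgnr_gt0 d6) (shared_class_refuted n3).
Qed.

End Labelled.

Section Labelled.
Variable R : realType.
Implicit Types p : nat -> 'rV[R]_2.

Lemma det_at_swap p i j k : det_at p i k j = - det_at p i j k.
Proof. by rewrite /det_at /det3; ring. Qed.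

Lemma shared_class_positive p z : shared_class p -> 0 < det_at p 0 1 2 ->
  z \in [:: 0; 1; 2; 6; 9]%N -> blocks (p z) (p 3%N) (p 4%N) -> False.
Proof.
move=> sh d0 iz bz; have [L b3 b4] := sh.
have n6 : det_at p 6 7 8 != 0 by exact: labelled_class_det.
case: (ltrgt0P (det_at p 6 7 8)) n6 => // d6 _; first exact: shared_class_oriented iz bz.
(* Swapping 7 and 8 reverses the third triangle and fixes every candidate [z]. *)
pose s := [:: 0; 1; 2; 3; 4; 5; 6; 8; 7; 9]%N.
have L' : labelled (fun i => p (nth 0%N s i)) by apply: labelled_relabel.
apply: (@shared_class_oriented R (fun i => p (nth 0%N s i)) z) => //.
  by rewrite /det_at /= -/(det_at p 6 8 7) det_at_swap oppr_gt0.
by move: iz bz; rewrite !inE => /or4P[||| /orP[]] /eqP->.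
Qed.

Lemma shared_class_few p z : shared_class p ->
  z \in [:: 0; 1; 2; 6; 9]%N -> blocks (p z) (p 3%N) (p 4%N) -> False.
Proof.
move=> sh iz bz; have [L b3 b4] := sh.
have n0 : det_at p 0 1 2 != 0 by exact: labelled_class_det.
case: (ltrgt0P (det_at p 0 1 2)) n0 => // d0 _; first exact: shared_class_positive iz bz.
(* Swapping 1 with 2 and 3 with 4 reverses the first triangle and exchanges the two blocked edges at
   0. *)
pose s := [:: 0; 2; 1; 4; 3; 5; 6; 7; 8; 9]%N.
have L' : labelled (fun i => p (nth 0%N s i)) by apply: labelled_relabel.
apply: (@shared_class_positive (fun i => p (nth 0%N s i)) (nth 0%N s z)) => //.
- by rewrite /det_at /= -/(det_at p 0 2 1) det_at_swap oppr_gt0.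
- by move: iz {bz}; rewrite !inE => /or4P[||| /orP[]] /eqP->.
- by apply: blocks_sym; move: iz bz; rewrite !inE => /or4P[||| /orP[]] /eqP->.
Qed.

Lemma shared_class_false p : shared_class p -> False.
Proof.
move=> sh; have [L b3 b4] := sh.
have [z [iz cz bz]] := @labelled_blocker R p 3 4 L isT isT isT erefl.
have [zs|zs] := boolP (z \in [:: 0; 1; 2; 6; 9]%N); first exact: shared_class_few zs bz.
(* Label 5 has the colour of 3, so only 7 and 8 remain; exchanging either with 6 leads back to an
   excluded candidate. *)
have : (z == 7%N) || (z == 8%N).
  by move: zs cz iz; rewrite !inE !negb_or /colour; lia.
case/orP=> /eqP e; rewrite {}e {cz iz zs z} in bz.
- pose s := [:: 0; 1; 2; 3; 4; 5; 7; 6; 8; 9]%N.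
  have L' : labelled (fun i => p (nth 0%N s i)) by apply: labelled_relabel.
  exact: (@shared_class_few (fun i => p (nth 0%N s i)) 6).
- pose s := [:: 0; 1; 2; 3; 4; 5; 8; 7; 6; 9]%N.
  have L' : labelled (fun i => p (nth 0%N s i)) by apply: labelled_relabel.
  exact: (@shared_class_few (fun i => p (nth 0%N s i)) 6).
Qed.

Lemma last_point_false p : labelled p ->
  blocks (p 9%N) (p 0%N) (p 1%N) -> blocks (p 9%N) (p 3%N) (p 4%N) ->
  blocks (p 9%N) (p 6%N) (p 7%N) ->
  0 < det_at p 0 1 2 -> 0 < det_at p 3 4 5 -> 0 < det_at p 6 7 8 -> False.
Proof.
move=> L b0 b3 b6 d0 d3 d6.
have esP : List.Forall (fun opts =>
    exists2 b, List.In b opts & block_ok (chi p) b) last_point_case.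
  apply: List.Forall_cons; first exact: (@choices_ok R p 0 1 9).
  apply: List.Forall_cons; first exact: (@choices_ok R p 3 4 9).
  apply: List.Forall_cons; first exact: (@choices_ok R p 6 7 9).
  by do 6!(apply: List.Forall_cons; first exact: edge_ok); exact: List.Forall_nil.
have := labelled_refute L esP.
by rewrite (sgnr_gt0 d0) (sgnr_gt0 d3) (sgnr_gt0 d6) last_point_refuted.
Qed.

Lemma colour_class_lt a s x : (a < 3)%N -> perm_eq s (colour_class a) -> x \in s ->
  (x < 9)%N /\ colour x = a.
Proof.
move=> ia ps; rewrite (perm_mem ps).
by case: a ia {ps} => [|[|[|]]] // _; rewrite !inE => /or3P[]/eqP->.
Qed.

(** Reduction to [shared_class]: the common vertex [v] takes label 0, and the blockers take 3 and
    4. *)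
Lemma no_two_blockers p v w w' x x' a : labelled p -> (a < 3)%N ->
    perm_eq [:: v; w; w'] (colour_class a) -> (x < 9)%N -> (x' < 9)%N ->
    colour x != a -> colour x' = colour x ->
  blocks (p x) (p v) (p w) -> blocks (p x') (p v) (p w') -> False.
Proof.
move=> L ia pv ix ix' cx cx' b b'.
have [[iv cv] [iw cw] [iw' cw']] : [/\ (v < 9)%N /\ colour v = a,
    (w < 9)%N /\ colour w = a & (w' < 9)%N /\ colour w' = a].
  by split; apply: (colour_class_lt ia pv); rewrite !inE eqxx ?orbT.
have uv : uniq [:: v; w; w'].
  by rewrite (perm_uniq pv); case: (a) ia => [|[|[|]]].
have neqc y z : colour z = a -> colour y = colour x -> z != y.
  by move=> cz cy; apply: contra_neq cx => e; rewrite -cy -e.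
(* A common blocker would put [v], [x], [w], [w'] on one line. *)
have xx' : x != x'.
  apply/eqP => e; rewrite -{}e in b' => {ix' cx' x'}.
  apply: (@labelled_four_collinear R p v x w w') => //.
  - by apply/and5P; split=> //; exact: ltnW.
  - move: uv; rewrite /= !inE !negb_or !andbT => /andP[/andP[-> ->] ->].
    by rewrite (neqc x v) // (eq_sym x) (neqc x w) // (eq_sym x) (neqc x w').
  - by case/blocks_det3: b => t _ /(_ (p v))[].
  - by case/blocks_det3: b' => t _ /(_ (p v))[].
have [x'' px] := colour_class_third ix ix' xx' (esym cx').
have cx3 : (colour x < 3)%N by rewrite /colour; lia.
(* The remaining triangle, as the colours 0, 1, 2 sum to 3. *)
pose c := (3 - a - colour x)%N.
have pabc : perm_eq [:: a; colour x; c] [:: 0; 1; 2]%N.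
  move: cx3 cx; rewrite /c; case: (colour x) => [|[|[|]]] //;
  by case: (a) ia => [|[|[|]]].
have rel := relabelling_blocks pabc pv px (perm_refl _).
by apply: (@shared_class_false (fun i => p (nth 0%N _ i))); split;
  first exact: labelled_relabel rel.
Qed.

(** Pigeonhole: otherwise the three edges have blockers in only two triangles, so two edges, which
    share a vertex, are blocked from the same one. Swapping [i] and [j] fixes the orientation. *)
Lemma class_blocked_by_last p a : labelled p -> (a < 3)%N -> exists i j k,
  [/\ perm_eq [:: i; j; k] (colour_class a), blocks (p 9%N) (p i) (p j) & 0 < det_at p i j k].
Proof.
move=> L ia.
suff [i [j [k [pa b]]]] : exists i j k,
    perm_eq [:: i; j; k] (colour_class a) /\ blocks (p 9%N) (p i) (p j).
  have [[ii ci] [ij cj] [ik ck]] : [/\ (i < 9)%N /\ colour i = a,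
      (j < 9)%N /\ colour j = a & (k < 9)%N /\ colour k = a].
    by split; apply: (colour_class_lt ia pa); rewrite !inE eqxx ?orbT.
  have u : uniq [:: i; j; k] by rewrite (perm_uniq pa); case: (a) ia => [|[|[|]]].
  have n0 : det_at p i j k != 0.
    by apply: labelled_class_det => //; rewrite ?ci ?cj ?ck //; exact: ltnW.
  case: (ltrgt0P (det_at p i j k)) n0 => // d _; first by exists i, j, k.
  exists j, i, k; split; last by rewrite /det_at det3C oppr_gt0.
    by rewrite -(permPr pa) (perm_catCA [:: j] [:: i] [:: k]).
  exact: blocks_sym.
pose i := (3 * a)%N; pose j := (3 * a + 1)%N; pose k := (3 * a + 2)%N.
have [ii ij ik] : [/\ (i < 10)%N, (j < 10)%N & (k < 10)%N] by split; lia.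
have [ci cj ck] : [/\ colour i = a, colour j = a & colour k = a].
  by rewrite /colour; split; lia.
have blocker m n : (m < 10)%N -> (n < 10)%N -> m != n -> colour m = a -> colour n = a ->
    exists x, [/\ (x < 10)%N, colour x != a & blocks (p x) (p m) (p n)].
  by move=> im in_ mn cm cn; rewrite -cm; apply: labelled_blocker; rewrite ?cm.
have [x [ix cx bx]] := blocker i j ii ij ltac:(lia) ci cj.
have [y [iy cy by_]] := blocker i k ii ik ltac:(lia) ci ck.
have [z [iz cz bz]] := blocker j k ij ik ltac:(lia) cj ck.
have nine t : (t < 10)%N -> t = 9%N \/ (t < 9)%N by lia.
have pijk : perm_eq [:: i; j; k] (colour_class a) by [].
have pjik : perm_eq [:: j; i; k] (colour_class a) by rewrite (perm_catCA [:: j] [:: i] [:: k]).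
have pikj : perm_eq [:: i; k; j] (colour_class a) by rewrite perm_cons (perm_catC [:: k] [:: j]).
have pkij : perm_eq [:: k; i; j] (colour_class a) by rewrite (perm_catCA [:: k] [:: i] [:: j]).
have pjki : perm_eq [:: j; k; i] (colour_class a).
  by rewrite -(permPr pjik) perm_cons (perm_catC [:: k] [:: i]).
case: (nine x ix) => [ex|{}ix]; first by exists i, j, k; rewrite -ex.
case: (nine y iy) => [ey|{}iy]; first by exists i, k, j; rewrite -ey.
case: (nine z iz) => [ez|{}iz]; first by exists j, k, i; rewrite -ez.
exfalso.
have [e|nyx] := eqVneq (colour y) (colour x); first exact: (no_two_blockers L ia pijk ix iy).
have [e|nzx] := eqVneq (colour z) (colour x).
  exact: (no_two_blockers L ia pjik ix iz cx e (blocks_sym bx) bz).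
have e : colour z = colour y.
  by move: ix iy iz cx cy cz nyx nzx; rewrite /colour; lia.
exact: (no_two_blockers L ia pkij iy iz cy e (blocks_sym by_) (blocks_sym bz)).
Qed.

(** Listing first, in each triangle, the edge blocked by the single point produces the second
    refuted configuration. *)
Theorem labelled_false p : ~ labelled p.
Proof.
move=> L.
have [i [j [k [p0 b0 d0]]]] := class_blocked_by_last L (isT : (0 < 3)%N).
have [i' [j' [k' [p1 b1 d1]]]] := class_blocked_by_last L (isT : (1 < 3)%N).
have [i'' [j'' [k'' [p2 b2 d2]]]] := class_blocked_by_last L (isT : (2 < 3)%N).
have rel := relabelling_blocks (perm_refl _) p0 p1 p2.
exact: (@last_point_false (fun i => p (nth 0%N _ i)) (labelled_relabel L rel)).
Qed.

End Labelled.

(** * Adding a colour class *)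

Lemma unit_interval_nonroot (R : realFieldType) (f : {poly R}) : f != 0 ->
  exists2 t, 0 < t < 1 & f.[t] != 0.
Proof.
(* The points 1/2, 1/3, and so on: [size f] of them, one more than the degree. *)
move=> f0; pose rs : seq R := [seq (i.+2%:R)^-1 | i <- iota 0 (size f)].
have u : uniq rs.
  rewrite map_inj_uniq ?iota_uniq // => i j /invr_inj /eqP.
  by rewrite eqr_nat => /eqP[].
have [/(max_poly_roots f0)/(_ u)|] := boolP (all (root f) rs).
  by rewrite size_map size_iota ltnn.
case/allPn => t /mapP[i _ ->] nr; exists (i.+2%:R)^-1; last by [].
by rewrite invr_gt0 ltr0n /= invf_lt1 ?ltr0n // ltr1n.
Qed.

Section Extension.
Variable R : realType.
Implicit Types (P Q : {fset 'rV[R]_2}) (u v w x y z : 'rV[R]_2).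

Lemma visible_sym P v w : visible P v w -> visible P w v.
Proof. by move=> vis [x xP b]; apply: vis; exists x => //; exact: blocks_sym. Qed.

Lemma blocks_det0 x v w : blocks x v w -> det3 v x w = 0.
Proof. by case/blocks_det3 => t _ /(_ v)[]. Qed.

(** Colours are natural numbers here, so that a fresh one can be added without changing the type. *)
Definition nat_blocking P (c : 'rV[R]_2 -> nat) :=
  forall v w, v \in P -> w \in P -> v != w -> (visible P v w <-> c v != c w).

Lemma add_colour_class P Q c k : nat_blocking P c -> (forall x, x \in P -> c x != k) ->
    (forall q, q \in Q -> q \notin P) ->
    (forall q u v, q \in Q -> u \in P -> v \in P -> u != v -> det3 q u v != 0) ->
    (forall q q', q \in Q -> q' \in Q -> q != q' -> exists2 x, x \in P & blocks x q q') ->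
  nat_blocking (P `|` Q) (fun x => if x \in P then c x else k).
Proof.
move=> bP cP QP gen bQ.
have mixed v w : v \in P -> w \in Q -> visible (P `|` Q) v w.
  move=> vP wQ [x]; rewrite in_fsetU => xPQ b.
  have wP := QP _ wQ; have vw : v != w by apply: contraNneq wP => <-.
  have xv := blocks_neq b vw.
  have xw : x != w by rewrite eq_sym in vw; exact: blocks_neq (blocks_sym b) vw.
  case/orP: xPQ => [xP|xQ].
    rewrite eq_sym in xv; case/eqP: (gen _ _ _ wQ vP xP xv).
    by rewrite -(blocks_det0 b) /det3; ring.
  (* A blocker [x] in [Q] is separated from [w] by some [y] in [P]. Then [w] lies on the line
     through [v] and [y], or [y = v] and the two orders along the line conflict. *)
  have [y yP by_] := bQ _ _ xQ wQ xw.
  have [e|vy] := eqVneq v y; last first.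
    case/eqP: (gen _ _ _ wQ vP yP vy); case: by_ => t [_ ->].
    by rewrite -[RHS](mulr0 (1 - t)) -(blocks_det0 b) /det3 !mxE; ring.
  rewrite -e in by_.
  have e' := blocks_antisym (blocks_sym b) (blocks_sym by_).
  by rewrite e' eqxx in vw.
move=> v w; rewrite !in_fsetU.
have [vP _|vP /= vQ] := boolP (v \in P); have [wP _|wP /= wQ] := boolP (w \in P) => vw.
- rewrite -(bP _ _ vP wP vw); split=> vis [x xP b]; apply: vis; exists x => //.
    by rewrite in_fsetU xP.
  move: xP; rewrite in_fsetU => /orP[//|xQ].
  case/eqP: (gen _ _ _ xQ vP wP vw).
  by rewrite det3C (blocks_det0 b) oppr0.
- by split=> _; [exact: cP | exact: mixed].
- split=> _; first by rewrite eq_sym; exact: cP.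
  exact/visible_sym/mixed.
- split=> [vis|]; last by rewrite eqxx.
  have [x xP b] := bQ _ _ vQ wQ vw.
  by case: vis; exists x; rewrite // in_fsetU xP.
Qed.

Lemma line_det3 u v x y z : u != v -> det3 x u v = 0 -> det3 y u v = 0 ->
  det3 z u v = 0 -> det3 x y z = 0.
Proof.
move=> uv dx dy dz.
have [r ->] := det3_0_line_point uv (etrans (det3_rot x u v) dx).
have [s ->] := det3_0_line_point uv (etrans (det3_rot y u v) dy).
have [t ->] := det3_0_line_point uv (etrans (det3_rot z u v) dz).
by rewrite /line_point /det3 !mxE; ring.
Qed.

(* The solution a of x = (1-t)a + tb, y = (1-t)b + tc, z = (1-t)c + ta. *)
Definition inscribing x y z (t : R) :=
  (1 - 3 * t + 3 * t ^+ 2)^-1 *: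
    ((1 - t) ^+ 2 *: x - (t * (1 - t)) *: y + t ^+ 2 *: z).

(** This is [(1 - t)^3 + t^3], the determinant of the cyclic system for [a], [b], [c]. *)
Lemma inscribing_den (t : R) : 1 - 3 * t + 3 * t ^+ 2 != 0.
Proof. rewrite gt_eqF //; have := sqr_ge0 (2 * t - 1); nra. Qed.

Lemma inscribing_blocks x y z t : 0 < t < 1 ->
  blocks x (inscribing x y z t) (inscribing y z x t).
Proof.
move=> t01; exists t; split=> //; have := inscribing_den t => d0.
by apply: row2P; rewrite !mxE; field.
Qed.

(** The determinant of a triangle vertex with [u] and [v], cleared of its denominator; roots are the
    parameters that put the vertex on that line. *)
Definition inscribing_poly u v x y z : {poly R} :=
  (1 - 'X) ^+ 2 * (det3 x u v)%:P - 'X * (1 - 'X) * (det3 y u v)%:P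
    + 'X ^+ 2 * (det3 z u v)%:P.

Lemma inscribing_polyE u v x y z t : (inscribing_poly u v x y z).[t] =
  (1 - 3 * t + 3 * t ^+ 2) * det3 (inscribing x y z t) u v.
Proof.
have := inscribing_den t => d0.
by rewrite /inscribing_poly !hornerE /= /det3 !mxE; field.
Qed.

Lemma inscribing_poly_neq0 u v x y z : u != v -> det3 x y z != 0 ->
  inscribing_poly u v x y z != 0.
Proof.
move=> uv; apply: contra_neq => e.
have ev t : (1 - t) ^+ 2 * det3 x u v - t * (1 - t) * det3 y u v
    + t ^+ 2 * det3 z u v = 0.
  by rewrite -(horner0 t) -e /inscribing_poly !hornerE.
(* The values at 0 and 1 isolate [x] and [z], and the value at 2 then gives [y]: all three would lie
   on the line through [u] and [v]. *)
have e0 := ev 0; have e1 := ev 1; have e2 := ev 2.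
have x0 : det3 x u v = 0 by lra.
have z0 : det3 z u v = 0 by lra.
by apply: (line_det3 uv) => //; rewrite x0 z0 in e2; lra.
Qed.

Lemma generic_triangle P x y z : det3 x y z != 0 -> exists a b c,
  [/\ blocks x a b, blocks y b c, blocks z c a &
      forall q u v, q \in [:: a; b; c] -> u \in P -> v \in P -> u != v ->
        det3 q u v != 0].
Proof.
move=> d0.
pose F (u v : 'rV[R]_2) : {poly R} := inscribing_poly u v x y z * inscribing_poly u v y z x *
  inscribing_poly u v z x y.
(* A single nonroot of this product avoids every line spanned by [P] for all three vertices at
   once. *)
pose G : {poly R} := \prod_(u <- P) \prod_(v <- P | u != v) F u v.
have G0 : G != 0.
  rewrite prodf_seq_neq0; apply/allP => u _ /=.
  rewrite prodf_seq_neq0; apply/allP => v _; apply/implyP => uv.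
  have dy : det3 y z x != 0 by rewrite det3_rot.
  have dz : det3 z x y != 0 by rewrite -det3_rot.
  have n1 := inscribing_poly_neq0 uv d0; have n2 := inscribing_poly_neq0 uv dy.
  have n3 := inscribing_poly_neq0 uv dz.
  by rewrite /F !mulf_eq0 !negb_or n1 n2.
have [t t01 Gt] := unit_interval_nonroot G0.
exists (inscribing x y z t), (inscribing y z x t), (inscribing z x y t).
split; try exact: inscribing_blocks.
move=> q u v iq uP vP uv.
have : (F u v).[t] != 0.
  apply: contra_neq Gt => Ft; rewrite /G (big_rem _ uP) /= hornerM.
  by rewrite (big_rem _ vP) /= uv hornerM Ft !mul0r.
rewrite !hornerM !inscribing_polyE !mulf_eq0 !negb_or.
by move: iq; rewrite !inE => /or3P[]/eqP-> /andP[/andP[]] => /andP[_ ?] /andP[_ ?] /andP[_ ?].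
Qed.

(** The noncollinear triple is carried along as the seed of the next extension. *)
Definition realizable (s : seq nat) := exists P c,
  [/\ nat_blocking P c, forall x, x \in P -> (c x < size s)%N,
      forall i, (i < size s)%N -> #|` [fset x in P | c x == i]| = nth 0%N s i &
      exists x y z, [/\ x \in P, y \in P, z \in P & det3 x y z != 0]].

Lemma realizable_rcons s m : (0 < m <= 3)%N -> realizable s -> realizable (rcons s m).
Proof.
move=> m3 [P [c [bP cP nP [x [y [z [xP yP zP d0]]]]]]].
have [a [b [d [bx by_ bz gen]]]] := generic_triangle P d0.
have xy : x != y by apply: contra_neq d0 => ->; rewrite /det3; ring.
(* A vertex in [P] would lie on a line spanned by itself and another point of [P], against
   genericity. *)
have notP q : q \in [:: a; b; d] -> q \notin P.
  move=> iq; apply/negP => qP.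
  have [e|qx] := eqVneq q x.
    by case/eqP: (gen q x y iq xP yP xy); rewrite e /det3; ring.
  by case/eqP: (gen q q x iq qP xP qx); rewrite /det3; ring.
have neq q q' w : q \in [:: a; b; d] -> w \in P -> blocks w q q' -> q != q'.
  move=> /notP qP wP bw; apply: contraNneq qP => e; move: bw wP; rewrite -e => -[t [_ ->]].
  by rewrite -scalerDl subrK scale1r.
have [ab bd da] : [/\ a != b, b != d & d != a].
  by split; [apply: (neq _ _ x)|apply: (neq _ _ y)|apply: (neq _ _ z)];
    rewrite ?inE ?eqxx ?orbT.
have uT : uniq (take m [:: a; b; d]).
  by apply: take_uniq; rewrite /= !inE negb_or ab bd eq_sym da.
pose Q : {fset 'rV[R]_2} := [fset q in take m [:: a; b; d]].
have QT q : q \in Q -> q \in [:: a; b; d] by rewrite inE; exact: mem_take.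
have QP q : q \in Q -> q \notin P by move/QT/notP.
exists (P `|` Q), (fun q => if q \in P then c q else size s); split.
- apply: add_colour_class => //.
  + by move=> u uP; rewrite neq_ltn cP.
  + by move=> q u v /QT; exact: gen.
  + move=> q q' /QT qT /QT q'T qq'.
    have [ad db ba] : [/\ blocks z a d, blocks y d b & blocks x b a].
      by split; exact: blocks_sym.
    move: qT q'T qq'; rewrite !inE => /or3P[]/eqP-> /or3P[]/eqP->; rewrite ?eqxx // => _;
    by [exists x|exists y|exists z].
- move=> q; rewrite size_rcons in_fsetU; case: ifP => [qP _|_ /=]; last by rewrite ltnS.
  by rewrite ltnS ltnW ?cP.
- move=> i; rewrite size_rcons ltnS nth_rcons leq_eqVlt => /orP[/eqP->|si].
    rewrite ltnn eqxx (_ : [fset q in _ | _] = Q).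
      by rewrite card_fseq undup_id // size_take /=; case: m m3 {uT Q QT QP} => [|[|[|[]]]].
    apply/fsetP => q; rewrite !inE /=; case: (boolP (q \in P)) => [qP|_] /=.
      rewrite ltn_eqF ?cP //; apply/esym/negbTE; apply: contraL qP => qQ.
      by apply: QP; rewrite inE.
    by rewrite eqxx andbT.
  rewrite si -nP //; congr #|` _|; apply/fsetP => q; rewrite !inE /=.
  case: (boolP (q \in P)) => //= _.
  by rewrite gtn_eqF ?andbF.
- by exists x, y, z; rewrite !in_fsetU xP yP zP.
Qed.

End Extension.

(** * Explicit blocked sets *)

Definition grid_det (u v w : int * int) : int :=
  (v.1 - u.1) * (w.2 - u.2) - (v.2 - u.2) * (w.1 - u.1).

(** For [x] on the line at parameter [t], the inner product is [t (1 - t)] times the squared length,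
    hence positive exactly inside the segment. *)
Definition grid_between (x v w : int * int) :=
  (grid_det v w x == 0) &&
  (0 < (x.1 - v.1) * (w.1 - x.1) + (x.2 - v.2) * (w.2 - x.2)).

Definition grid_blocked (L : seq (int * int * nat)) :=
  [&& uniq (unzip1 L),
      all (fun v => all (fun w => (v.1 != w.1) ==>
        (has (fun x => grid_between x.1 v.1 w.1) L == (v.2 == w.2))) L) L &
      has (fun u => has (fun v => has (fun w => grid_det u.1 v.1 w.1 != 0) L) L) L].

Section Grid.
Variable R : realType.

Definition grid_point (u : int * int) : 'rV[R]_2 :=
  \row_(i < 2) (if i == 0 then u.1 else u.2)%:~R.

Lemma grid_point_inj : injective grid_point.
Proof.
move=> [u0 u1] [v0 v1] /rowP e; have := e 0; have := e 1; rewrite !mxE /=.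
by move=> /eqP; rewrite eqr_int => /eqP-> /eqP; rewrite eqr_int => /eqP->.
Qed.

Lemma det3_grid u v w :
  det3 (grid_point u) (grid_point v) (grid_point w) = (grid_det u v w)%:~R.
Proof. by rewrite /det3 /grid_det !mxE /= rmorphB !rmorphM !rmorphB. Qed.

Lemma blocks_between (x v w : 'rV[R]_2) : v != w ->
  blocks x v w <-> det3 v w x = 0 /\
    0 < (x 0 0 - v 0 0) * (w 0 0 - x 0 0) + (x 0 1 - v 0 1) * (w 0 1 - x 0 1).
Proof.
move=> vw.
have n0 : 0 < (w 0 0 - v 0 0) ^+ 2 + (w 0 1 - v 0 1) ^+ 2.
  rewrite lt0r addr_ge0 ?sqr_ge0 // andbT paddr_eq0 ?sqr_ge0 // !sqrf_eq0 !subr_eq0.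
  by apply: contra_neqN vw => /andP[/eqP e0 /eqP e1]; exact: row2P.
have dotE t y : y = line_point v w t ->
    (y 0 0 - v 0 0) * (w 0 0 - y 0 0) + (y 0 1 - v 0 1) * (w 0 1 - y 0 1) =
    (t * (1 - t)) * ((w 0 0 - v 0 0) ^+ 2 + (w 0 1 - v 0 1) ^+ 2).
  by move=> ->; rewrite !mxE; ring.
split=> [[t [/andP[t0 t1] xE]]|[d0]].
  have xE' : x = line_point v w t by rewrite xE; apply: row2P; rewrite !mxE; ring.
  rewrite (dotE _ _ xE') pmulr_lgt0 // mulr_gt0 ?subr_gt0 //; split=> //.
  by rewrite xE /det3 !mxE; ring.
have [t xE] := det3_0_line_point vw d0.
rewrite (dotE _ _ xE) pmulr_lgt0 // => t01; exists t; split.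
  by apply/andP; split; nra.
by rewrite xE; apply: row2P; rewrite !mxE; ring.
Qed.

Lemma blocks_grid x v w : v != w ->
  blocks (grid_point x) (grid_point v) (grid_point w) <-> grid_between x v w.
Proof.
move=> vw; rewrite blocks_between ?(inj_eq grid_point_inj) // det3_grid !mxE /=.
rewrite -!rmorphB -!rmorphM -rmorphD ltr0z /grid_between.
split=> [[/eqP]|/andP[/eqP-> ->]]; last by split.
by rewrite intr_eq0 => -> ->.
Qed.

Definition colour_sizes n (L : seq (int * int * nat)) :=
  [seq count (fun l => l.2 == i) L | i <- iota 0 n].

Lemma grid_realizable n L : grid_blocked L -> all (fun l => (l.2 < n)%N) L ->
  realizable R (colour_sizes n L).
Proof.
case/and3P => uL /allP bL /hasP[u uL' /hasP[v vL /hasP[w wL d]]] /allP cL.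
pose f (l : int * int * nat) := grid_point l.1.
have uf : uniq (map f L) by rewrite (map_comp grid_point) map_inj_uniq //; exact: grid_point_inj.
pose c q := (nth (0, 0, 0%N) L (index q (map f L))).2.
have cE l : l \in L -> c (f l) = l.2.
  move=> lL; rewrite /c -[in f l](nth_index (0, 0, 0%N) lL).
  by rewrite -(nth_map _ (f (0, 0, 0%N))) ?index_mem // index_uniq ?size_map ?index_mem // nth_index.
pose P : {fset 'rV[R]_2} := [fset q in map f L].
have fP l : l \in L -> f l \in P by move=> lL; rewrite inE; exact: map_f.
have Pf q : q \in P -> exists2 l, l \in L & q = f l.
  by rewrite inE => /mapP[l lL ->]; exists l.
exists P, c; split.
- move=> _ _ /Pf[a aL ->] /Pf[b bL' ->] ab; rewrite !cE //.
  have nab : a.1 != b.1 by apply: contra_neq ab => e; rewrite /f e.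
  have /allP/(_ b bL') := bL a aL; rewrite nab /= => /eqP <-.
  split=> [vis|/hasPn nb [_ /Pf[x xL ->]]].
    apply/hasP => -[x xL bx]; apply: vis; exists (f x); first exact: fP.
    exact/blocks_grid.
  by move/(blocks_grid _ nab); apply/negP/nb.
- by move=> _ /Pf[l lL ->]; rewrite size_map size_iota cE ?cL.
- move=> i; rewrite size_map size_iota => iN.
  rewrite (nth_map 0%N) ?size_iota // nth_iota // add0n.
  rewrite (_ : [fset _ in _ | _] = [fset q in map f [seq l <- L | l.2 == i]]).
    rewrite card_fseq undup_id ?size_map ?size_filter //.
    by apply: subseq_uniq uf; apply: map_subseq; exact: filter_subseq.
  apply/fsetP => q; rewrite !inE /=; apply/andP/mapP => [[/mapP[l lL ->]]|[l]].
    by rewrite cE // => li; exists l; rewrite // mem_filter li.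
  by rewrite mem_filter => /andP[li lL] ->; rewrite cE // map_f.
- by exists (f u), (f v), (f w); rewrite !fP // det3_grid intr_eq0.
Qed.

End Grid.

(* Invariant under the order three map (x, y) -> (-y, x - y). *)
Definition grid3333 : seq (int * int * nat) :=
  [:: (-7, -4, 0%N); (4, -3, 1%N); (3, 7, 2); (-3, -3, 3); (3, 0, 3); (0, 3, 3);
      (-3, -1, 2); (1, -2, 0%N); (2, 3, 1%N); (-2, -1, 1%N); (1, -1, 2); (1, 2, 0%N)].

Definition grid111 : seq (int * int * nat) :=
  [:: (0, 0, 0%N); (1, 0, 1%N); (0, 1, 2)].
Definition grid112 : seq (int * int * nat) :=
  [:: (0, 0, 0%N); (1, 0, 1%N); (2, 0, 0%N); (0, 1, 2)].
Definition grid122 : seq (int * int * nat) :=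
  [:: (0, 0, 0%N); (1, 0, 1%N); (-1, 0, 1%N); (0, 1, 2); (0, -1, 2)].
Definition grid222 : seq (int * int * nat) :=
  [:: (0, 0, 0%N); (1, 0, 1%N); (0, 1, 2); (2, 0, 0%N); (-1, 2, 1%N); (0, -1, 2)].
Definition grid1133 : seq (int * int * nat) :=
  [:: (0, 0, 0%N); (-2, -2, 0%N); (2, -2, 0%N); (0, -2, 1%N); (-2, 0, 1%N);
      (2, 0, 1%N); (-1, -1, 2); (1, -1, 3)].

Definition subgrid (l : seq nat) := [seq nth (0, 0, 0%N) grid3333 i | i <- l].

(** * Representability of the types with parts at most three *)

Section Representable.
Variable R : realType.

Definition realizable_up_to_order (s : seq nat) :=
  exists2 s', perm_eq s' s & realizable R s'.

Lemma realizable_grid s L : grid_blocked L ->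
    all (fun l => (l.2 < size s)%N) L && perm_eq (colour_sizes (size s) L) s ->
  realizable_up_to_order s.
Proof.
move=> bL /andP[cL pL]; exists (colour_sizes (size s) L) => //.
exact: grid_realizable.
Qed.

Lemma realizable_cat s s' : all (fun m => (0 < m <= 3)%N) s ->
  realizable_up_to_order s' -> realizable_up_to_order (s ++ s').
Proof.
elim: s => //= m s IH /andP[m3 /IH/[apply]] [r pr rr].
exists (rcons r m); last exact: realizable_rcons.
by rewrite perm_rcons perm_cons.
Qed.

Lemma realizable_perm s s' : perm_eq s s' -> realizable_up_to_order s ->
  realizable_up_to_order s'.
Proof. by move=> ps [r pr rr]; exists r => //; exact: perm_trans pr ps. Qed.

Definition sizes i j l := nseq i 1%N ++ nseq j 2%N ++ nseq l 3%N.

Lemma perm_sizes s : all (fun m => (0 < m <= 3)%N) s ->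
  exists i j l, perm_eq s (sizes i j l).
Proof.
elim: s => [|m s IH /= /andP[m3 /IH[i [j [l ps]]]]]; first by exists 0%N, 0%N, 0%N.
have [->|->|->] : [\/ m = 1, m = 2 | m = 3]%N.
  by case: m m3 => [|[|[|[]]]] //; constructor.
- by exists i.+1, j, l; rewrite perm_cons.
- exists i, j.+1, l; apply: (perm_trans (y := 2%N :: sizes i j l)); first by rewrite perm_cons.
  apply/seq.permP => a; rewrite /= !count_cat !count_nseq.
  by case: (a 1%N); case: (a 2); case: (a 3); lia.
- exists i, j, l.+1; apply: (perm_trans (y := 3%N :: sizes i j l)); first by rewrite perm_cons.
  apply/seq.permP => a; rewrite /= !count_cat !count_nseq.
  by case: (a 1%N); case: (a 2); case: (a 3); lia.
Qed.

(** The surplus parts are added one by one as new colour classes, so it suffices to realise minimal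
    types. *)
Lemma realizable_sizes i j l i' j' l' : (i <= i')%N -> (j <= j')%N -> (l <= l')%N ->
  realizable_up_to_order (sizes i j l) -> realizable_up_to_order (sizes i' j' l').
Proof.
move=> ii jj ll rs.
apply: (realizable_perm (s := sizes (i' - i) (j' - j) (l' - l) ++ sizes i j l)).
  rewrite -{2}(subnK ii) -{2}(subnK jj) -{2}(subnK ll).
  by apply/seq.permP => a; rewrite !count_cat !count_nseq !mulnDr; lia.
by apply: realizable_cat => //; rewrite !all_cat !all_nseq !orbT.
Qed.

(** Three parts below 3 already contain a three-class base without 3s. Otherwise at least two parts
    are 3, and apart from the excluded type one of five four-class bases fits. *)
Lemma realizable_except_1333 s : all (fun m => (0 < m <= 3)%N) s -> (4 <= size s)%N ->
  ~~ perm_eq s [:: 1; 3; 3; 3]%N -> realizable_up_to_order s.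
Proof.
move=> s3 s4 n1333; have [i [j [l ps]]] := perm_sizes s3.
apply: (realizable_perm (s := sizes i j l)); first by rewrite perm_sym.
have n : ~~ [&& i == 1, j == 0 & l == 3]%N.
  by apply: contra n1333 => /and3P[/eqP ei /eqP ej /eqP el]; rewrite (permPl ps) ei ej el.
have {s3 s4 n1333 ps} ijl : (4 <= i + j + l)%N.
  by rewrite -addnA; move: s4; rewrite (perm_size ps) !size_cat !size_nseq.
have base i' j' l' L : grid_blocked L ->
    all (fun x => (x.2 < i' + j' + l')%N) L &&
    perm_eq (colour_sizes (i' + j' + l')%N L) (sizes i' j' l') ->
    (i' <= i)%N -> (j' <= j)%N -> (l' <= l)%N -> realizable_up_to_order (sizes i j l).
  move=> bL cL ii jj ll; apply: (realizable_sizes ii jj ll).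
  apply: (realizable_grid bL).
  by rewrite /sizes !size_cat !size_nseq addnA.
have [ij3|ij2] := leqP 3 (i + j).
  case: (ltngtP i 1%N) => [i0|i2|i1].
  - by apply: (@base 0 3 0 grid222)%N; [vm_compute | vm_compute | lia | lia | lia].
  - have [j0|j0] := posnP j.
      by apply: (@base 3 0 0 grid111)%N; [vm_compute | vm_compute | lia | lia | lia].
    by apply: (@base 2 1 0 grid112)%N; [vm_compute | vm_compute | lia | lia | lia].
  - by apply: (@base 1 2 0 grid122)%N; [vm_compute | vm_compute | lia | lia | lia].
have [[i2 l2]|[[i1 [j1 l2]]|[[j2 l2]|[[j1 l3]|l4]]]] :
    (2 <= i /\ 2 <= l \/ (1 <= i /\ 1 <= j /\ 2 <= l) \/ (2 <= j /\ 2 <= l) \/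
     (1 <= j /\ 3 <= l) \/ 4 <= l)%N by lia.
- by apply: (@base 2 0 2 grid1133)%N; [vm_compute | vm_compute | lia | lia | lia].
- by apply: (@base 1 1 2 (subgrid [:: 0; 3; 4; 5; 6; 7; 9; 10; 11]))%N;
    [vm_compute | vm_compute | lia | lia | lia].
- by apply: (@base 0 2 2 (subgrid [:: 0; 1; 3; 4; 5; 6; 7; 9; 10; 11]))%N;
    [vm_compute | vm_compute | lia | lia | lia].
- by apply: (@base 0 1 3 (subgrid [:: 0; 1; 3; 4; 5; 6; 7; 8; 9; 10; 11]))%N;
    [vm_compute | vm_compute | lia | lia | lia].
- by apply: (@base 0 0 4 grid3333)%N; [vm_compute | vm_compute | lia | lia | lia].
Qed.

End Representable.

(** * The characterisation *)

Lemma realizable_representable (R : realType) (k : nat) (n : k.-tuple nat) :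
  (0 < k)%N -> realizable_up_to_order R n -> representable R n.
Proof.
case: k n => // k n _ [s ps [P [c [bP cP nP _]]]].
have ss : size s == k.+1 by rewrite (perm_size ps) size_tuple.
have [p np] : exists p : 'S_k.+1, n = [tuple tnth (Tuple ss) (p i) | i < k.+1] :> seq nat.
  by apply/tuple_permP; rewrite perm_sym.
have cE x : x \in P -> (inord (c x) : 'I_k.+1) = c x :> nat.
  by move=> xP; rewrite inordK // -(eqP ss) cP.
exists P, (fun x => inord (c x)); split.
  move=> v w vP wP vw; rewrite (bP _ _ vP wP vw) -(inj_eq val_inj) /=.
  by rewrite !cE.
exists p => i.
have -> : tnth n i = tnth (Tuple ss) (p i).
  by rewrite (val_inj np : n = [tuple _ | _ < _]) tnth_mktuple.
rewrite (tnth_nth 0%N) /= -nP ?(eqP ss) //; congr #|` _|.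
apply/fsetP => x; rewrite !inE /=; case: (boolP (x \in P)) => //= xP.
by rewrite -(inj_eq val_inj) /= cE.
Qed.

Lemma not_representable_1333 (R : realType) (n : 4.-tuple nat) :
  perm_eq n [:: 3; 3; 3; 1]%N -> ~ representable R n.
Proof.
move=> pn [P [c [bP [s nP]]]].
have [p np] : exists p : 'S_4, n = [tuple tnth [tuple 3; 3; 3; 1]%N (p i) | i < 4] :> seq nat.
  exact/tuple_permP.
(* The colour of the class at place [j] in the order 3, 3, 3, 1: undo the sorting [p] of the sizes,
   then pass to colours by [s]. *)
pose e j := s ((p^-1)%g j).
pose A j : seq _ := enum_fset [fset x in P | c x == e j].
have eI : injective e by move=> i j /perm_inj/perm_inj.
have sA j : size (A j) = tnth [tuple 3; 3; 3; 1]%N j.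
  by rewrite nP (val_inj np : n = [tuple _ | _ < _]) tnth_mktuple permKV.
have memA j x : (x \in A j) = (x \in P) && (c x == e j).
  by rewrite -[LHS]/(x \in [fset x in P | c x == e j]) !inE.
pose L := A 0 ++ A 1 ++ A 2%:R ++ A 3%:R.
have sL : size L = 10%N by rewrite !size_cat !sA.
have AL j x : x \in A j -> x \in L.
  have : j \in [:: 0; 1; 2%:R; 3%:R] by case: j => [[|[|[|[|]]]]].
  by rewrite !mem_cat !inE => /or4P[]/eqP-> ->; rewrite ?orbT.
have PL x : x \in P -> x \in L.
  move=> xP; apply: (AL (p ((s^-1)%g (c x)))).
  by rewrite memA xP /e permK permKV /=.
have LP (x : 'rV[R]_2) j : x \in A j -> x \in P by rewrite memA => /andP[].
have nA i j : i != j -> ~~ has (mem (A i)) (A j).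
  move=> ij; apply/hasPn => x; rewrite /= !memA => /andP[_ /eqP cj].
  by rewrite cj (inj_eq eI) eq_sym (negPf ij) andbF.
have uA j : uniq (A j) by exact: fset_uniq.
have uL : uniq L by rewrite !cat_uniq !uA !has_cat !negb_or !nA.
pose cl (i : nat) : 'I_4 := inord (colour i).
pose q i := nth 0 L i.
have qA i : (i < 10)%N -> q i \in A (cl i).
  have Ai (j : 'I_4) m : (m < tnth [tuple 3; 3; 3; 1]%N j)%N -> nth 0 (A j) m \in A j.
    by rewrite -sA; exact: mem_nth.
  have [t0 t1 t2] : [/\ tnth [tuple 3; 3; 3; 1]%N 0 = 3%N,
    tnth [tuple 3; 3; 3; 1]%N 1 = 3%N & tnth [tuple 3; 3; 3; 1]%N 2%:R = 3%N] by [].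
  rewrite /q /L !nth_cat !sA t0 t1 t2 => i10.
  have -> : cl i = if (i < 3)%N then 0 else if (i < 6)%N then 1 else
     if (i < 9)%N then 2%:R else 3%:R.
    by apply: ord_inj; move: i i10; do 10?[case=> [_|]; first by rewrite /cl inordK].
  case: ltnP => i3; first exact: Ai.
  rewrite ltn_subLR //; case: ltnP => i6; first by apply: Ai; rewrite t1; lia.
  rewrite -subnDA ltn_subLR //; case: ltnP => i9; first by apply: Ai; rewrite t2; lia.
  by apply: Ai; rewrite /tnth /=; lia.
apply: (@labelled_false R q); split.
- move=> i j i10 j10 /eqP; rewrite nth_uniq ?sL // => /eqP //.
- move=> i j i10 j10 ij cij.
  have nij : q i != q j by rewrite nth_uniq ?sL.
  have := qA _ i10; have := qA _ j10; rewrite !memA.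
  case/andP=> qj /eqP cj /andP[qi /eqP ci].
  have : ~ visible P (q i) (q j).
    by rewrite (bP _ _ qi qj nij) ci cj /cl cij eqxx.
  move/contrapT => [x /PL xL b]; exists (index x L); first by rewrite -sL index_mem.
  by rewrite /q nth_index.
- move=> i j x i10 j10 x10 b.
  have := qA _ i10; have := qA _ j10; have := qA _ x10; rewrite !memA.
  case/andP=> qx _ /andP[qj /eqP cj] /andP[qi /eqP ci].
  have [->//|ij] := eqVneq i j.
  have nij : q i != q j by rewrite nth_uniq ?sL.
  have nv : ~ visible P (q i) (q j) by apply; exists (q x).
  have : c (q i) = c (q j) by apply: contra_notP nv => /eqP; apply: (bP _ _ qi qj nij).2.
  rewrite ci cj => /eI /(congr1 val); rewrite /cl /= !inordK /colour; lia.
Qed.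

Local Close Scope ring_scope.
Local Close Scope fset_scope.

Theorem proposition12 (R : realType) (k : nat) (n : k.-tuple nat)
    (hk : 4 <= k) (hn : forall i : 'I_k, 0 < tnth n i <= 3) :
  representable R n <-> ~~ perm_eq n [:: 1; 3; 3; 3].
Proof.
split=> [rep|n1333].
  apply/negP => pn; have k4 : k = 4%N by rewrite -(size_tuple n) (perm_size pn).
  subst k; apply: not_representable_1333 rep.
  by rewrite (permPl pn).
apply: realizable_representable; first exact: leq_trans hk.
apply: realizable_except_1333; rewrite ?size_tuple //.
by apply/all_tnthP.
Qed.
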